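(* Let $k$ be an algebraically closed field, let $Q,Q'$ be finite quivers with rational weights $\theta,\theta'$ and dimension vectors $d,d'$ (all components positive), and let $\overline{\theta}=(\theta_a+\theta'_{a'})_{(a,a')}$ and $\bar d=(d_ad'_{a'})_{(a,a')}$ for $Q\otimes Q'$. Assume $d$ is coprime and $\theta$-coprime, $d'$ is coprime and $\theta'$-coprime, and $\bar d$ is $\overline{\theta}$-coprime. Let $r_a$ ($a\in Q_0$), $r'_{a'}$ ($a'\in Q_0'$) be integers with $\sum_{a}d_ar_a=1$ and $\sum_{a'}d'_{a'}r'_{a'}=1$, and put $\bar r_{(a,a')}=r_ar'_{a'}$. Let $N_1,N_2,N_3$ be the (fine) moduli spaces of stable representations of $(Q,\theta,d)$, $(Q',\theta',d')$, $(Q\otimes Q',\overline{\theta},\bar d)$ and let $(U_1,\psi_1),(U_2,\psi_2),(U_3,\psi_3)$ be the universal families on them constructed using the integers $r_a$, $r'_{a'}$ and $\bar r_{(a,a')}$ respectively. Let $\bar\phi:N_1\times N_2\to N_3$ be the morphism induced by the tensor product of representations. Then, for each $(a,a')\in Q_0\times Q'_0$, the vector bundles $\bar\phi^*U_{3,(a,a')}$ and $\mathrm{pr}_1^*(U_{1,a})\otimes\mathrm{pr}_2^*(U_{2,a'})$ on $N_1\times N_2$ are isomorphic, where $\mathrm{pr}_j:N_1\times N_2\to N_j$ ($j=1,2$) is the projection map.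
   Context: Quivers and stability. A quiver $Q=(Q_0,Q_1,\mathrm{s},\mathrm{t})$ consists of finite sets $Q_0\neq\emptyset$, $Q_1$ and source and target maps $\mathrm{s},\mathrm{t}:Q_1\to Q_0$. A representation over $k$ is a family $(V_a)_{a\in Q_0}$ of finite-dimensional vector spaces with linear maps $\rho_\alpha:V_{\mathrm{s}(\alpha)}\to V_{\mathrm{t}(\alpha)}$; its type is $(\dim V_a)_a$. For $0\ne d\in\mathbf{N}^{Q_0}$ and a weight $\theta\in\mathbf{R}^{Q_0}$: $\mu_\theta(d)=\left(\sum_a\theta_ad_a\right)/\left(\sum_ad_a\right)$; the slope of a non-zero representation is the slope of its type. A non-zero representation is $\theta$-stable if every non-zero proper subrepresentation has strictly smaller slope (semistable: $\le$). $d$ is coprime if $\gcd(d_a\mid a\in Q_0)=1$, and $\theta$-coprime if $\mu_\theta(e)\neq\mu_\theta(d)$ for all $0<e<d$ in $\mathbf{N}^{Q_0}$ (componentwise order). Internal product. $Q\otimes Q'$ has vertices $Q_0\times Q_0'$ and arrows $(Q_0\times Q_1')\sqcup(Q_1\times Q_0')$, with $(a,\alpha')$ going from $(a,\mathrm{s}(\alpha'))$ to $(a,\mathrm{t}(\alpha'))$ and $(\alpha,a')$ from $(\mathrm{s}(\alpha),a')$ to $(\mathrm{t}(\alpha),a')$. Moduli spaces. Fix $V_a$ with $\dim V_a=d_a$. Let $\mathcal{A}_1=\bigoplus_{\alpha\in Q_1}\mathrm{Hom}(V_{\mathrm{s}(\alpha)},V_{\mathrm{t}(\alpha)})$, $G_1=\prod_{a\in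 Q_0}\mathrm{Aut}(V_a)$ acting on the right by $(\rho g)_\alpha=g_{\mathrm{t}(\alpha)}^{-1}\circ\rho_\alpha\circ g_{\mathrm{s}(\alpha)}$, $\Delta_1=\{(c\mathbf{1}_{V_a})_a\mid c\in k^\times\}$, $\bar G_1=\Delta_1\backslash G_1$, and let $\mathcal{A}_1^{\mathrm{s}}$ be the set of $\rho$ with $(V,\rho)$ $\theta$-stable (equal to the semistable locus here). $N_1$ is the geometric quotient of $\mathcal{A}_1^{\mathrm{s}}$ by $\bar G_1$, with quotient map $p_1:\mathcal{A}_1^{\mathrm{s}}\to N_1$. Define $\mathcal{A}_2,G_2,p_2,N_2$ in the same way from $(Q',\theta',d')$ and fixed spaces $W_{a'}$ with $\dim W_{a'}=d'_{a'}$, and $\mathcal{A}_3,G_3,p_3,N_3$ from $(Q\otimes Q',\overline{\theta},\bar d)$ and the spaces $V_a\otimes W_{a'}$. The map $\bar\phi$. Let $\phi:\mathcal{A}_1\times\mathcal{A}_2\to\mathcal{A}_3$, $\phi(\rho,\sigma)=\big((\rho_\alpha\otimes\mathbf{1}_{W_{a'}})_{(\alpha,a')},(\mathbf{1}_{V_a}\otimes\sigma_{\alpha'})_{(a,\alpha')}\big)$. It maps $\mathcal{A}_1^{\mathrm{s}}\times\mathcal{A}_2^{\mathrm{s}}$ into $\mathcal{A}_3^{\mathrm{s}}$, and $\bar\phi$ is the unique morphism with $\bar\phi\circ(p_1\times p_2)=p_3\circ\phi$. Universal families. Given integers $r_a$ with $\sum_ad_ar_a=1$, let $\chi_1(g)=\prod_a\det(g_a)^{-r_a}$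 on $G_1$. Let $G_1$ act on the trivial bundle $E_a=\mathcal{A}_1^{\mathrm{s}}\times V_a$ by $(\rho,v)g=(\rho g,\chi_1(g)^{-1}g_a^{-1}(v))$. Then $\Delta_1$ acts trivially, and $E_a$ descends to a vector bundle $U_{1,a}$ on $N_1$, i.e. $p_1^*U_{1,a}\cong E_a$ equivariantly. The equivariant bundle maps $(\rho,v)\mapsto(\rho,\rho_\alpha(v))$ from $E_{\mathrm{s}(\alpha)}$ to $E_{\mathrm{t}(\alpha)}$ descend to maps $\psi_{1,\alpha}:U_{1,\mathrm{s}(\alpha)}\to U_{1,\mathrm{t}(\alpha)}$; $(U_1,\psi_1)=((U_{1,a})_a,(\psi_{1,\alpha})_\alpha)$ is the universal family on $N_1$. $(U_2,\psi_2)$ and $(U_3,\psi_3)$ are constructed in the same way from the integers $r'_{a'}$ and $\bar r_{(a,a')}$. *)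

(* Defs.v *)
From HB Require Import structures.
From mathcomp Require Import all_boot all_order all_algebra.
From mathcomp Require Import all_classical topology.
From mathcomp.real_closed Require Import mxtens.

Set Implicit Arguments.
Unset Strict Implicit.
Unset Printing Implicit Defensive.
Import Order.TTheory GRing.Theory Num.Theory.

Local Open Scope classical_set_scope.
Local Open Scope ring_scope.

(** Over an algebraically closed field, varieties are treated as spaces with
  functions (in the sense of Kempf and Serre): a topological space with a sheaf of
  algebras of k-valued functions such that, if f is regular on U, then the
  nonvanishing locus of f in U is open and 1/f is regular there. The sheaf is
  given by its germs: [regular_at f x] says that f is regular on a
  neighbourhood of x, and k[U] consists of the f that are regular at all points of U.
  Only the values of f near x matter ([regular_at_eq]). *)

Record funSpace (k : fieldType) := FunSpace {
  carrier :> topologicalType;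
  regular_at : (carrier -> k) -> carrier -> Prop;
  regular_at_near : forall f x,
    regular_at f x -> \forall y \near x, regular_at f y;
  regular_at_eq : forall f g x,
    (\forall y \near x, f y = g y) -> regular_at f x -> regular_at g x;
  regular_at_cst : forall c x, regular_at (fun=> c) x;
  regular_atD : forall f g x,
    regular_at f x -> regular_at g x -> regular_at (fun y => f y + g y) x;
  regular_atM : forall f g x,
    regular_at f x -> regular_at g x -> regular_at (fun y => f y * g y) x;
  regular_atV : forall f x, regular_at f x -> f x != 0 ->
    (\forall y \near x, f y != 0) /\ regular_at (fun y => (f y)^-1) x }.

Definition regular_on (k : fieldType) (X : funSpace k) (U : set X)
    (f : X -> k) : Prop :=
  open U /\ forall x, U x -> regular_at f x.

Record morphism (k : fieldType) (X Y : funSpace k) := Morphism {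
  mor_fun :> X -> Y;
  mor_continuous : continuous mor_fun;
  mor_regular : forall (g : Y -> k) (x : X),
    regular_at g (mor_fun x) -> regular_at (g \o mor_fun) x }.

Definition isomorphic (k : fieldType) (X Y : funSpace k) : Prop :=
  exists (f : morphism X Y) (g : morphism Y X), cancel f g /\ cancel g f.

Lemma regular_on_of_at (k : fieldType) (X : funSpace k) (f : X -> k) (x : X) :
  regular_at f x -> exists U, regular_on U f /\ U x.
Proof.
move=> /regular_at_near fx; exists (interior [set y | regular_at f y]).
split; last exact: fx.
by split; [exact: open_interior|move=> y /interior_subset].
Qed.

(** The coarsest structure of space with functions on a set T for which, for
  all (U, f) in a given family B, U is open and f is regular on U: the domains
  of the pairs in [generated] are a base of the topology, and the regular
  functions are those that are locally the second component of such a pair. *)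
Definition gen_carrier (k : fieldType) (T : Type)
  (B : set T -> (T -> k) -> Prop) : Type := T.

Section Generated.
Variables (k : fieldType) (T : Type) (B : set T -> (T -> k) -> Prop).

Inductive generated : set T -> (T -> k) -> Prop :=
| Generated_base U f : B U f -> generated U f
| Generated_cst c : generated setT (fun=> c)
| Generated_add U V f g : generated U f -> generated V g ->
    generated (U `&` V) (fun x => f x + g x)
| Generated_mul U V f g : generated U f -> generated V g ->
    generated (U `&` V) (fun x => f x * g x)
| Generated_inv U f : generated U f ->
    generated (U `&` [set x | f x != 0]) (fun x => (f x)^-1).

Local Notation GT := (gen_carrier B).

HB.instance Definition _ := gen_eqMixin GT.
HB.instance Definition _ := gen_choiceMixin GT.

Definition gen_open : set_system GT := fun A =>
  forall x, A x -> exists U f, [/\ generated U f, U x & U `<=` A].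

Let gen_openT : gen_open setT.
Proof.
by move=> x _; exists setT, (fun=> 0); split => //; exact: Generated_cst.
Qed.

Let gen_openI : setI_closed gen_open.
Proof.
move=> A C oA oC x [Ax Cx].
have [U [f [gU Ux UA]]] := oA x Ax; have [V [g [gV Vx VC]]] := oC x Cx.
exists (U `&` V), (fun x => f x + g x); split => //.
- exact: Generated_add.
- by move=> y [/UA ? /VC].
Qed.

Let gen_open_bigU (I : Type) (f : I -> set GT) :
  (forall i, gen_open (f i)) -> gen_open (\bigcup_i f i).
Proof.
move=> of_ x [i _ fix_]; have [U [g [gU Ux Uf]]] := of_ i x fix_.
by exists U, g; split => // y Uy; exists i => //; exact: Uf.
Qed.

HB.instance Definition _ :=
  isOpenTopological.Build GT gen_openT gen_openI gen_open_bigU.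

Lemma gen_nearE (x : GT) (P : set GT) : (\forall y \near x, P y) <->
  exists U f, [/\ generated U f, U x & U `<=` P].
Proof.
split=> [[A [oA Ax AP]]|[U [f [gU Ux UP]]]].
  have [U [f [gU Ux UA]]] := oA x Ax.
  by exists U, f; split => // y /UA/AP.
by exists U; split => // y Uy; exists U, f; split.
Qed.

Definition gen_regular_at (f : GT -> k) (x : GT) : Prop :=
  exists U g, [/\ generated U g, U x & forall y, U y -> f y = g y].

Let gen_near f x : gen_regular_at f x -> \forall y \near x, gen_regular_at f y.
Proof.
case=> U [g [gU Ux fg]]; apply/gen_nearE; exists U, g; split => // y Uy.
by exists U, g.
Qed.

Let gen_eq f g x : (\forall y \near x, f y = g y) ->
  gen_regular_at f x -> gen_regular_at g x.
Proof.
move=> /gen_nearE[V [l [gV Vx fg]]] [U [h [gU Ux fh]]].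
exists (U `&` V), (fun x => h x + 0 * l x); split => //.
  have -> : U `&` V = U `&` (setT `&` V) by rewrite setTI.
  by apply: Generated_add => //; apply: Generated_mul => //;
    exact: Generated_cst.
by move=> y [Uy /fg <-]; rewrite mul0r addr0; exact: fh.
Qed.

Let gen_cst c x : gen_regular_at (fun=> c) x.
Proof. by exists setT, (fun=> c); split => //; exact: Generated_cst. Qed.

Let gen_add f g x : gen_regular_at f x -> gen_regular_at g x ->
  gen_regular_at (fun y => f y + g y) x.
Proof.
move=> [U [f' [gU Ux ff]]] [V [g' [gV Vx gg]]].
exists (U `&` V), (fun x => f' x + g' x); split => //.
  exact: Generated_add.
by move=> y [/ff -> /gg ->].
Qed.

Let gen_mul f g x : gen_regular_at f x -> gen_regular_at g x ->
  gen_regular_at (fun y => f y * g y) x.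
Proof.
move=> [U [f' [gU Ux ff]]] [V [g' [gV Vx gg]]].
exists (U `&` V), (fun x => f' x * g' x); split => //.
  exact: Generated_mul.
by move=> y [/ff -> /gg ->].
Qed.

Let gen_inv f x : gen_regular_at f x -> f x != 0 ->
  (\forall y \near x, f y != 0) /\ gen_regular_at (fun y => (f y)^-1) x.
Proof.
move=> [U [g [gU Ux fg]]] fx0.
have gV := Generated_inv gU; have gx : g x != 0 by rewrite -fg.
split; last by exists (U `&` [set x | g x != 0]), (fun x => (g x)^-1);
  split => // y [/fg -> _].
apply/gen_nearE; eexists _, _; split; [exact: gV|by []|].
by move=> y [/fg -> ].
Qed.

Definition gen_space : funSpace k :=
  FunSpace gen_near gen_eq gen_cst gen_add gen_mul gen_inv.

Lemma gen_base_open U f : B U f -> open (U : set gen_space).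
Proof.
move=> BUf; rewrite openE => x Ux; apply/gen_nearE.
by exists U, f; split => //; exact: Generated_base.
Qed.

Lemma gen_base_regular U f (x : gen_space) :
  B U f -> U x -> regular_at (f : gen_space -> k) x.
Proof.
by move=> BUf Ux; exists U, f; split => //; exact: Generated_base.
Qed.

Lemma gen_space_morphism (X : funSpace k) (h : X -> gen_space) :
  (forall U f, B U f -> regular_on (h @^-1` U) (f \o h)) ->
  continuous h /\ (forall (g : gen_space -> k) x,
    regular_at g (h x) -> regular_at (g \o h) x).
Proof.
move=> hB.
have hgen U f : generated U f -> regular_on (h @^-1` U) (f \o h).
  elim=> {U f} [U f /hB//|c|U V f g _ [oU rf] _ [oV rg]
    |U V f g _ [oU rf] _ [oV rg]|U f _ [oU rf]].
  - by split; [exact: openT|move=> x _; exact: regular_at_cst].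
  - by split; [exact: openI|move=> x [/rf ? /rg ?]; exact: regular_atD].
  - by split; [exact: openI|move=> x [/rf ? /rg ?]; exact: regular_atM].
  - split; last by move=> x [/rf rfx /= fx]; have [] := regular_atV rfx fx.
    rewrite openE => x [Ux fx]; have [ne _] := regular_atV (rf _ Ux) fx.
    by apply: filterI => //; exact: open_nbhs_nbhs.
split=> [x A /gen_nearE[U [f [/hgen[oU _] Ux UA]]]|g x [U [f [gU Ux gf]]]].
  rewrite /= nbhs_simpl /=.
  apply: (@filterS _ _ _ (h @^-1` U)) => [y /UA//|].
  exact: open_nbhs_nbhs.
have [oU rf] := hgen _ _ gU.
apply: regular_at_eq (rf x Ux).
apply: (@filterS _ _ _ (h @^-1` U)) => [y /gf//|].
exact: open_nbhs_nbhs.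
Qed.

End Generated.

(** The points of the subspace on A are the pairs of a point of X and a proof
  that it lies in A; [incl] is the inclusion. *)
Section Subspace.
Variables (k : fieldType) (X : funSpace k) (A : set X).

Definition subspace_gen (V : set A) (f : A -> k) : Prop :=
  exists U g, [/\ regular_on U g, V = [set x : A | U (\val x)] &
                 f = (fun x : A => g (\val x))].

Definition subspace : funSpace k := gen_space subspace_gen.

Let incl_fun (x : subspace) : X := \val (x : A).

Let incl_continuous : continuous incl_fun.
Proof.
apply/continuousP => U oU.
apply: (@gen_base_open _ _ subspace_gen _ (fun=> 0)).
by exists U, (fun=> 0); split => //; split => // x _; exact: regular_at_cst.
Qed.

Let incl_regular (g : X -> k) x :
  regular_at g (incl_fun x) -> regular_at (g \o incl_fun) x.
Proof.
move=> /regular_on_of_at[U [gU Ux]].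
apply: (@gen_base_regular _ _ subspace_gen (incl_fun @^-1` U)) => //.
by exists U, g.
Qed.

Definition incl : morphism subspace X := Morphism incl_continuous incl_regular.

End Subspace.

(** The product of spaces with functions (for varieties, the product
  variety); its topology is in general finer than the product topology. *)
Section Product.
Variables (k : fieldType) (X Y : funSpace k).

Definition prod_gen (V : set (X * Y)) (f : X * Y -> k) : Prop :=
  (exists U g, [/\ regular_on U g, V = fst @^-1` U & f = g \o fst]) \/
  (exists U g, [/\ regular_on U g, V = snd @^-1` U & f = g \o snd]).

Definition prod_space : funSpace k := gen_space prod_gen.

Let fst_fun (z : prod_space) : X := (z : X * Y).1.
Let snd_fun (z : prod_space) : Y := (z : X * Y).2.

Let fst_continuous : continuous fst_fun.
Proof.
apply/continuousP => U oU.
apply: (@gen_base_open _ _ prod_gen _ (fun=> 0)); left.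
by exists U, (fun=> 0); split => //; split => // x _; exact: regular_at_cst.
Qed.

Let snd_continuous : continuous snd_fun.
Proof.
apply/continuousP => U oU.
apply: (@gen_base_open _ _ prod_gen _ (fun=> 0)); right.
by exists U, (fun=> 0); split => //; split => // x _; exact: regular_at_cst.
Qed.

Let fst_regular (g : X -> k) z :
  regular_at g (fst_fun z) -> regular_at (g \o fst_fun) z.
Proof.
move=> /regular_on_of_at[U [gU Ux]].
apply: (@gen_base_regular _ _ prod_gen (fst_fun @^-1` U)) => //.
by left; exists U, g.
Qed.

Let snd_regular (g : Y -> k) z :
  regular_at g (snd_fun z) -> regular_at (g \o snd_fun) z.
Proof.
move=> /regular_on_of_at[U [gU Ux]].
apply: (@gen_base_regular _ _ prod_gen (snd_fun @^-1` U)) => //.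
by right; exists U, g.
Qed.

Definition pr1 : morphism prod_space X := Morphism fst_continuous fst_regular.
Definition pr2 : morphism prod_space Y := Morphism snd_continuous snd_regular.

End Product.

(** The Zariski topology, and the functions that are locally rational in the
  coordinates with nonvanishing denominators. *)
Definition affine_space (k : fieldType) (n : nat) : funSpace k :=
  @gen_space k 'cV[k]_n
    (fun U f => U = setT /\ exists i, f = fun x : 'cV[k]_n => x i 0).

Definition affine_variety (k : fieldType) (X : funSpace k) : Prop :=
  exists (n : nat) (Z : set (affine_space k n)),
    closed Z /\ isomorphic X (subspace Z).

(** Varieties are reduced and separated of finite type, but need not be
  irreducible. *)
Definition variety (k : fieldType) (X : funSpace k) : Prop :=
  (exists (m : nat) (U : 'I_m -> set X),
     [/\ forall i, open (U i), forall x, exists i, U i x &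
        forall i, affine_variety (subspace (U i))]) /\
  closed ([set z | pr1 X X z = pr2 X X z] : set (prod_space X X)).

(** Geometric quotient of X by a group action with orbit relation [orb]. The
  invariant functions on p^-1(U) are the f \o p with f a function on U. *)
Definition geometric_quotient (k : fieldType) (X N : funSpace k)
    (orb : X -> X -> Prop) (p : morphism X N) : Prop :=
  [/\ variety N,
      forall y, exists x, p x = y,
      forall x x', p x = p x' <-> orb x x',
      forall U : set N, open (p @^-1` U) -> open U &
      forall (U : set N) (f : N -> k), open U ->
        regular_on (p @^-1` U) (f \o p) -> regular_on U f].

Definition mx_regular_at (k : fieldType) (X : funSpace k) (m n : nat)
    (M : X -> 'M[k]_(m, n)) (x : X) : Prop :=
  forall i j, regular_at (fun y => M y i j) x.

(** A vector bundle is a family of finite-dimensional vector spaces, the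
  fibres, with an atlas of fibrewise linear trivialisations whose transition
  functions are regular. The total space is {x : X & fiber E x}. *)
Record vbundle (k : fieldType) (X : funSpace k) (n : nat) := VBundle {
  fiber : X -> vectType k;
  atlas : Type;
  chart_dom : atlas -> set X;
  chart : forall (i : atlas) (x : X), 'Hom(fiber x, 'cV[k]_n);
  chart_dom_open : forall i, open (chart_dom i);
  chart_dom_cover : forall x, exists i, chart_dom i x;
  chart_bij : forall i x, chart_dom i x -> bijective (chart i x);
  chart_transition : forall i j x, chart_dom i x -> chart_dom j x ->
    exists M : X -> 'M[k]_n, mx_regular_at M x /\
      \forall y \near x, forall v, chart j y v = M y *m chart i y v }.

Definition bundle_map (k : fieldType) (X : funSpace k) (m n : nat)
    (E : vbundle X m) (F : vbundle X n)
    (f : forall x, 'Hom(fiber E x, fiber F x)) : Prop :=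
  forall x (i : atlas E) (j : atlas F), chart_dom i x -> chart_dom j x ->
    exists M : X -> 'M[k]_(n, m), mx_regular_at M x /\
      \forall y \near x, forall v, chart j y (f y v) = M y *m chart i y v.

Definition bundle_iso (k : fieldType) (X : funSpace k) (m n : nat)
    (E : vbundle X m) (F : vbundle X n)
    (f : forall x, 'Hom(fiber E x, fiber F x)) : Prop :=
  bundle_map f /\ exists g : forall x, 'Hom(fiber F x, fiber E x),
    bundle_map g /\ forall x, cancel (f x) (g x) /\ cancel (g x) (f x).

Definition bundle_isomorphic (k : fieldType) (X : funSpace k) (m n : nat)
    (E : vbundle X m) (F : vbundle X n) : Prop :=
  exists f : forall x, 'Hom(fiber E x, fiber F x), bundle_iso f.

Section TrivialBundle.
Variables (k : fieldType) (X : funSpace k) (n : nat).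

Let triv_bij (i : unit) (x : X) : setT x ->
  bijective (\1%VF : 'End('cV[k]_n)).
Proof. by move=> _; exists id => v; rewrite id_lfunE. Qed.

Let triv_trans (i j : unit) (x : X) : setT x -> setT x ->
  exists M : X -> 'M[k]_n, mx_regular_at M x /\
    \forall y \near x, forall v : 'cV[k]_n,
      (\1%VF : 'End('cV[k]_n)) v = M y *m (\1%VF : 'End('cV[k]_n)) v.
Proof.
move=> _ _; exists (fun=> 1%:M); split; first by move=> r s; exact: regular_at_cst.
by apply: nearW => y v; rewrite id_lfunE mul1mx.
Qed.

Definition trivial_bundle : vbundle X n :=
  @VBundle k X n (fun=> 'cV[k]_n) unit (fun=> setT) (fun _ _ => \1%VF)
    (fun=> openT) (fun x => ex_intro _ tt I) triv_bij triv_trans.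

End TrivialBundle.

Section Pullback.
Variables (k : fieldType) (X Y : funSpace k) (f : morphism X Y).
Variables (n : nat) (E : vbundle Y n).

Let pb_open (i : atlas E) : open (f @^-1` chart_dom i).
Proof.
by move/continuousP: (@mor_continuous _ _ _ f); apply; exact: chart_dom_open.
Qed.

Let pb_trans (i j : atlas E) (x : X) :
  (f @^-1` chart_dom i) x -> (f @^-1` chart_dom j) x ->
  exists M : X -> 'M[k]_n, mx_regular_at M x /\
    \forall y \near x, forall v, chart j (f y) v = M y *m chart i (f y) v.
Proof.
move=> ix jx; have [M [rM nM]] := chart_transition ix jx.
exists (M \o f); split; first by move=> r s; exact: (mor_regular (rM r s)).
exact: (@mor_continuous _ _ _ f x _ nM).
Qed.

Definition pullback : vbundle X n :=
  @VBundle k X n (fun x => fiber E (f x)) (atlas E)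
    (fun i => f @^-1` chart_dom i) (fun i x => chart i (f x)) pb_open
    (fun x => chart_dom_cover E (f x)) (fun i x => @chart_bij _ _ _ E i (f x))
    pb_trans.

End Pullback.

(** For finite-dimensional V and W, the tensor product is realised as
  Hom(V^*, W), the pure tensor of v and w being xi |-> xi(v) w. *)
Section TensorSpace.
Variables (k : fieldType) (V W : vectType k).

Definition dual : vectType k := 'Hom(V, k^o).
Definition tensor_space : vectType k := 'Hom(dual, W).

Definition pure_tensor (v : V) (w : W) : tensor_space :=
  linfun (fun xi : dual => (xi v : k) *: w).

(** The map induced by f : V -> k^m and g : W -> k^n, where the tensor product of
  k^m and k^n is k^(mn) as in [tensmx]; see [tensor_coord_pure]. *)
Definition coord_form m (f : 'Hom(V, 'cV[k]_m)) (i : 'I_m) : dual :=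
  linfun (fun v => f v i 0 : k^o).

Definition tensor_coord m n (f : 'Hom(V, 'cV[k]_m)) (g : 'Hom(W, 'cV[k]_n)) :
    'Hom(tensor_space, 'cV[k]_(m * n)) :=
  linfun (fun t : tensor_space => \col_l
    (g (t (coord_form f (mxtens_unindex l).1)) (mxtens_unindex l).2 0)).

Lemma coord_formE m (f : 'Hom(V, 'cV[k]_m)) i v : coord_form f i v = f v i 0.
Proof.
have lf : linear (fun v => f v i 0 : k^o).
  by move=> c u w; rewrite linearP !mxE.
pose h := GRing.isLinear.Build _ _ _ _ _ lf.
pose F : {linear V -> k^o} := HB.pack (fun v => f v i 0 : k^o) h.
by rewrite (lfunE F).
Qed.

Lemma tensor_coordE m n (f : 'Hom(V, 'cV[k]_m)) (g : 'Hom(W, 'cV[k]_n)) t i j :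
  tensor_coord f g t (mxtens_index (i, j)) 0 = g (t (coord_form f i)) j 0.
Proof.
pose T := (fun t : tensor_space => \col_l
    (g (t (coord_form f (mxtens_unindex l).1)) (mxtens_unindex l).2 0)).
have lT : linear T.
  by move=> c u w; apply/colP => l; rewrite !mxE add_lfunE scale_lfunE linearP !mxE.
pose h := GRing.isLinear.Build _ _ _ _ _ lT.
pose F : {linear _ -> _} := HB.pack T h.
by rewrite (lfunE F) !mxE mxtens_indexK.
Qed.

Lemma pure_tensorE v w xi : pure_tensor v w xi = (xi v : k) *: w.
Proof.
have lT : linear (fun xi : dual => (xi v : k) *: w).
  by move=> c u z; rewrite add_lfunE scale_lfunE scalerDl scalerA.
pose h := GRing.isLinear.Build _ _ _ _ _ lT.
pose F : {linear dual -> W} := HB.pack (fun xi : dual => (xi v : k) *: w) h.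
by rewrite (lfunE F).
Qed.

Lemma tensor_coord_pure m n (f : 'Hom(V, 'cV[k]_m)) (g : 'Hom(W, 'cV[k]_n)) v w :
  tensor_coord f g (pure_tensor v w) = tensmx (f v) (g w).
Proof.
apply/colP => l; case: (mxtens_indexP l) => i j.
rewrite tensor_coordE [pure_tensor _ _ _]pure_tensorE coord_formE.
have -> : g (f v i 0 *: w) = f v i 0 *: g w by exact: linearZ.
rewrite !mxE !mxtens_indexK /=.
by congr (f v _ _ * g w _ _); apply: val_inj; rewrite /= ?modn1 ?divn1.
Qed.

Lemma tensor_coord_bij m n (f : 'Hom(V, 'cV[k]_m)) (g : 'Hom(W, 'cV[k]_n)) :
  bijective f -> bijective g -> bijective (tensor_coord f g).
Proof.
move=> [f' fK f'K] [g' gK g'K].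
have lg' : linear g'.
  move=> c u w; apply: (can_inj gK).
  by rewrite linearP /= !g'K.
pose hg := GRing.isLinear.Build _ _ _ _ _ lg'.
pose G : {linear 'cV[k]_n -> W} := HB.pack g' hg.
pose e i : V := f' (delta_mx i 0).
have dualE (xi : dual) : xi = \sum_i (xi (e i) : k) *: coord_form f i.
  apply/lfunP => v; rewrite sum_lfunE.
  have {1}-> : v = \sum_i f v i 0 *: e i.
    apply: (can_inj fK); rewrite linear_sum; apply/colP => j.
    rewrite summxE (bigD1 j) //= big1 => [|i ij]; last first.
      by rewrite linearZ /= f'K !mxE eq_sym (negbTE ij) mulr0.
    by rewrite linearZ /= f'K !mxE !eqxx mulr1 addr0.
  rewrite linear_sum; apply: eq_bigr => i _.
  by rewrite linearZ scale_lfunE coord_formE; exact: mulrC.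
pose h (c : 'cV[k]_(m * n)) : tensor_space :=
  \sum_i pure_tensor (e i) (g' (\col_j c (mxtens_index (i, j)) 0)).
exists h => [t|c].
  apply/lfunP => xi; rewrite sum_lfunE [in RHS](dualE xi) linear_sum.
  apply: eq_bigr => i _; rewrite pure_tensorE linearZ; congr (_ *: _).
  apply: (can_inj gK); rewrite g'K; apply/colP => j.
  by rewrite mxE tensor_coordE.
apply/colP => l; case: (mxtens_indexP l) => i j.
rewrite tensor_coordE sum_lfunE (bigD1 i) //= big1 => [|i' ii']; last first.
  by rewrite pure_tensorE coord_formE f'K !mxE eq_sym (negbTE ii') scale0r.
by rewrite addr0 pure_tensorE coord_formE f'K !mxE !eqxx scale1r g'K mxE.
Qed.

Lemma tensor_coord_mul m n (f f' : 'Hom(V, 'cV[k]_m)) (g g' : 'Hom(W, 'cV[k]_n))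
    (A : 'M[k]_m) (B : 'M[k]_n) :
  (forall v, f' v = A *m f v) -> (forall w, g' w = B *m g w) ->
  forall t, tensor_coord f' g' t = tensmx A B *m tensor_coord f g t.
Proof.
move=> f'E g'E t; apply/colP => l; case: (mxtens_indexP l) => i j.
rewrite tensor_coordE g'E.
have -> : coord_form f' i = \sum_i' A i i' *: coord_form f i'.
  apply/lfunP => v; rewrite coord_formE f'E sum_lfunE mxE.
  by apply: eq_bigr => i' _; rewrite scale_lfunE coord_formE.
rewrite [LHS]mxE [RHS]mxE (reindex (fun ij : 'I_m * 'I_n => mxtens_index ij)) /=; last first.
  by exists (@mxtens_unindex m n) => ij _; rewrite ?mxtens_indexK ?mxtens_unindexK.
transitivity (\sum_(i' < m) \sum_(j' < n)
    tensmx A B (mxtens_index (i, j)) (mxtens_index (i', j')) *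
    tensor_coord f g t (mxtens_index (i', j')) 0); last first.
  by rewrite pair_bigA; apply: eq_bigr => -[].
rewrite exchange_big /=; apply: eq_bigr => j' _.
rewrite linear_sum /= linear_sum /= summxE mulr_sumr; apply: eq_bigr => i' _.
rewrite tensmxE tensor_coordE.
have -> : t (A i i' *: coord_form f i') = A i i' *: t (coord_form f i').
  by rewrite linearZ.
have -> : g (A i i' *: t (coord_form f i')) =
    A i i' *: g (t (coord_form f i')) by rewrite linearZ.
by rewrite mxE mulrCA mulrA.
Qed.

End TensorSpace.

Section TensorBundle.
Variables (k : fieldType) (X : funSpace k) (m n : nat).
Variables (E : vbundle X m) (F : vbundle X n).

Let tens_open (ij : atlas E * atlas F) :
  open (chart_dom ij.1 `&` chart_dom ij.2).
Proof. by apply: openI; exact: chart_dom_open. Qed.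

Let tens_cover x :
  exists ij : atlas E * atlas F, (chart_dom ij.1 `&` chart_dom ij.2) x.
Proof.
have [i ix] := chart_dom_cover E x; have [j jx] := chart_dom_cover F x.
by exists (i, j).
Qed.

Let tens_bij (ij : atlas E * atlas F) x :
  (chart_dom ij.1 `&` chart_dom ij.2) x ->
  bijective (tensor_coord (chart ij.1 x) (chart ij.2 x)).
Proof. by move=> [/chart_bij bE /chart_bij bF]; exact: tensor_coord_bij. Qed.

Let tens_trans (ij ij' : atlas E * atlas F) x :
  (chart_dom ij.1 `&` chart_dom ij.2) x ->
  (chart_dom ij'.1 `&` chart_dom ij'.2) x ->
  exists M : X -> 'M[k]_(m * n), mx_regular_at M x /\
    \forall y \near x, forall t,
      tensor_coord (chart ij'.1 y) (chart ij'.2 y) t =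
      M y *m tensor_coord (chart ij.1 y) (chart ij.2 y) t.
Proof.
move=> [iE iF] [jE jF].
have [A [rA nA]] := chart_transition iE jE.
have [B [rB nB]] := chart_transition iF jF.
exists (fun y => tensmx (A y) (B y)); split.
  move=> r s.
  apply: (@regular_at_eq _ _ (fun y =>
    A y (mxtens_unindex r).1 (mxtens_unindex s).1 *
    B y (mxtens_unindex r).2 (mxtens_unindex s).2)).
    by apply: nearW => y; rewrite mxE.
  exact: regular_atM.
apply: filterS2 nA nB => y Ay By t; exact: tensor_coord_mul.
Qed.

Definition tensor_bundle : vbundle X (m * n) :=
  @VBundle k X (m * n) (fun x => tensor_space (fiber E x) (fiber F x))
    (atlas E * atlas F) (fun ij => chart_dom ij.1 `&` chart_dom ij.2)
    (fun ij x => tensor_coord (chart ij.1 x) (chart ij.2 x))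
    tens_open tens_cover tens_bij tens_trans.

End TensorBundle.

Record quiver := Quiver {
  vertex : finType;
  arrow : finType;
  src : arrow -> vertex;
  tgt : arrow -> vertex;
  vertex_neq0 : (0 < #|vertex|)%N }.

Definition slope (Q : quiver) (theta : vertex Q -> rat) (e : vertex Q -> nat) :
    rat :=
  (\sum_a theta a * (e a)%:R) / (\sum_a (e a)%:R).

Definition coprime_dim (Q : quiver) (d : vertex Q -> nat) : Prop :=
  \big[gcdn/0%N]_a d a = 1%N.

Definition slope_coprime (Q : quiver) (theta : vertex Q -> rat)
    (d : vertex Q -> nat) : Prop :=
  forall e : vertex Q -> nat, (forall a, (e a <= d a)%N) ->
    (exists a, e a <> 0%N) -> (exists a, e a <> d a) ->
    slope theta e <> slope theta d.

(** Representations of type d, on the spaces V_a = k^(d_a) of column vectors. *)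
Definition rep (k : fieldType) (Q : quiver) (d : vertex Q -> nat) : Type :=
  forall alpha : arrow Q, 'M[k]_(d (tgt alpha), d (src alpha)).

Definition subrep (k : fieldType) (Q : quiver) (d : vertex Q -> nat)
    (rho : rep k d) (S : forall a, {vspace 'cV[k]_(d a)}) : Prop :=
  forall alpha v, v \in S (src alpha) -> rho alpha *m v \in S (tgt alpha).

Definition stable (k : fieldType) (Q : quiver) (theta : vertex Q -> rat)
    (d : vertex Q -> nat) (rho : rep k d) : Prop :=
  (exists a, d a <> 0%N) /\
  forall S : forall a, {vspace 'cV[k]_(d a)}, subrep rho S ->
    (exists a, S a <> 0%VS) -> (exists a, S a <> fullv) ->
    slope theta (fun a => \dim (S a)) < slope theta d.

Section InternalProduct.
Variables Q Q' : quiver.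

Let prod_vertex : finType := (vertex Q * vertex Q')%type.
Let prod_arrow : finType :=
  ((vertex Q * arrow Q') + (arrow Q * vertex Q'))%type.

Let prod_src (beta : prod_arrow) : prod_vertex :=
  match beta with
  | inl u => (u.1, src u.2)
  | inr u => (src u.1, u.2)
  end.

Let prod_tgt (beta : prod_arrow) : prod_vertex :=
  match beta with
  | inl u => (u.1, tgt u.2)
  | inr u => (tgt u.1, u.2)
  end.

Let prod_vertex_neq0 : (0 < #|prod_vertex|)%N.
Proof. by rewrite card_prod muln_gt0 !vertex_neq0. Qed.

Definition tensor_quiver : quiver :=
  Quiver prod_src prod_tgt prod_vertex_neq0.

Definition tensor_weight (theta : vertex Q -> rat) (theta' : vertex Q' -> rat)
    (b : vertex tensor_quiver) : rat := theta b.1 + theta' b.2.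

Definition tensor_dim (d : vertex Q -> nat) (d' : vertex Q' -> nat)
    (b : vertex tensor_quiver) : nat := (d b.1 * d' b.2)%N.

Definition tensor_int (r : vertex Q -> int) (r' : vertex Q' -> int)
    (b : vertex tensor_quiver) : int := r b.1 * r' b.2.

(** The tensor product of k^m and k^n is identified with k^(mn) by [tensmx]. *)
Definition tensor_rep (k : fieldType) (d : vertex Q -> nat)
    (d' : vertex Q' -> nat) (rho : rep k d) (sigma : rep k d') :
    rep k (tensor_dim d d') :=
  fun beta => match beta with
  | inl u => tensmx (1%:M : 'M[k]_(d u.1)) (sigma u.2)
  | inr u => tensmx (rho u.1) (1%:M : 'M[k]_(d' u.2))
  end.

End InternalProduct.

Section Semistability.
Variables (k : fieldType) (Q : quiver) (theta : vertex Q -> rat).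
Variables (d : vertex Q -> nat) (rho : rep k d).
Hypothesis rho_stable : stable theta rho.

Lemma sum_dim_gt0 (e : vertex Q -> nat) :
  (exists a, e a <> 0%N) -> 0 < \sum_a (e a)%:R :> rat.
Proof.
move=> [a /eqP ea]; rewrite (bigD1 a) //=.
by rewrite ltr_wpDr ?ltr0n ?lt0n // sumr_ge0.
Qed.

Lemma slope_sum (e : vertex Q -> nat) (mu : rat) :
  \sum_a (theta a - mu) * (e a)%:R =
  \sum_a theta a * (e a)%:R - mu * \sum_a (e a)%:R.
Proof.
by rewrite mulr_sumr -sumrB; apply: eq_bigr => a _; rewrite mulrBl.
Qed.

Lemma slope_le (e : vertex Q -> nat) (mu : rat) : (exists a, e a <> 0%N) ->
  (slope theta e <= mu) = (\sum_a (theta a - mu) * (e a)%:R <= 0).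
Proof.
by move=> /sum_dim_gt0 e0; rewrite /slope ler_pdivrMr // slope_sum subr_le0.
Qed.

Lemma stable_semistable (S : forall a, {vspace 'cV[k]_(d a)}) : subrep rho S ->
  \sum_a (theta a - slope theta d) * (\dim (S a))%:R <= 0.
Proof.
case: rho_stable => d0 st SS.
have [S0|S0] := pselect (exists a, S a <> 0%VS); last first.
  rewrite big1 // => a _; have -> : S a = 0%VS.
    by apply: contrapT => Sa; apply: S0; exists a.
  by rewrite dimv0 mulr0.
have [S1|S1] := pselect (exists a, S a <> fullv).
  rewrite -(slope_le (e := fun a => \dim (S a))) ?ltW //; first exact: st.
  by case: S0 => a Sa; exists a => /eqP; rewrite dimv_eq0 => /eqP.
rewrite (eq_bigr (fun a => (theta a - slope theta d) * (d a)%:R)) => [|a _].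
  by rewrite -slope_le.
have -> : S a = fullv by apply: contrapT => Sa; apply: S1; exists a.
by rewrite dimvf /dim /= muln1.
Qed.

Lemma copies_semistable (n : nat) (X : vertex Q -> vectType k)
    (R : forall alpha, 'Hom(X (src alpha), X (tgt alpha)))
    (pi : 'I_n -> forall a, 'Hom(X a, 'cV[k]_(d a)))
    (M : forall a, {vspace X a}) :
  (forall a v, (forall l, pi l a v = 0) -> v = 0) ->
  (forall l alpha v,
     pi l (tgt alpha) (R alpha v) = rho alpha *m pi l (src alpha) v) ->
  (forall alpha v, v \in M (src alpha) -> R alpha v \in M (tgt alpha)) ->
  \sum_a (theta a - slope theta d) * (\dim (M a))%:R <= 0.
Proof.
move=> pi_inj piR MR.
pose F (j : nat) a : {vspace X a} :=
  (M a :&: \bigcap_(l < n | (j <= l)%N) lker (pi l a))%VS.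
have FP j a v : reflect (v \in M a /\ forall l : 'I_n, (j <= l)%N -> pi l a v = 0)
    (v \in F j a).
  rewrite memv_cap; apply: (iffP andP) => -[vM vK]; split => //.
    move=> l jl; apply/eqP; rewrite -memv_ker.
    by apply: subvP vK; exact: bigcapv_inf (subvv _).
  by rewrite memvE; apply/subv_bigcapP => l jl; rewrite -memvE memv_ker vK.
have dimF j : (j <= n)%N ->
    \sum_a (theta a - slope theta d) * (\dim (F j a))%:R <= 0.
  elim: j => [_|j IH jn].
    rewrite big1 // => a _; suff -> : F 0%N a = 0%VS by rewrite dimv0 mulr0.
    apply/eqP; rewrite -subv0; apply/subvP => v /FP[_ v0]; rewrite memv0.
    by apply/eqP/pi_inj => l; exact: v0.
  pose l := Ordinal jn.
  pose S a := (pi l a @: F j.+1 a)%VS.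
  have SS : subrep rho S.
    move=> alpha v /memv_imgP[u /FP[uM u0] ->]; rewrite -piR memv_img //.
    apply/FP; split; first exact: MR.
    by move=> l' jl'; rewrite piR u0 // mulmx0.
  have FE a : \dim (F j.+1 a) = (\dim (F j a) + \dim (S a))%N.
    rewrite -(limg_ker_dim (pi l a) (F j.+1 a)); congr (\dim _ + _)%N.
    apply/vspaceP => v; rewrite memv_cap memv_ker.
    apply/andP/FP => [[/FP[vM v0] /eqP vl]|[vM v0]]; split => //.
    - move=> l'; rewrite leq_eqVlt => /predU1P[jl'|/v0//].
      by have -> : l' = l by exact: val_inj.
    - by apply/FP; split => // l' /ltnW; exact: v0.
    - by apply/eqP/v0.
  under eq_bigr do rewrite FE natrD mulrDr.
  by rewrite big_split /= -[leRHS]addr0 lerD ?IH ?stable_semistable // ltnW.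
have := dimF n (leqnn n); congr (_ <= _); apply: eq_bigr => a _.
congr (_ * (\dim _)%:R); apply/vspaceP => v; apply/FP/idP => [[]//|vM].
by split=> // l; rewrite leqNgt ltn_ord.
Qed.

End Semistability.

Section TensorStable.
Variables (k : fieldType) (Q Q' : quiver).
Variables (theta : vertex Q -> rat) (theta' : vertex Q' -> rat).
Variables (d : vertex Q -> nat) (d' : vertex Q' -> nat).

Lemma slope_tensor_dim : (exists a, d a <> 0%N) -> (exists a, d' a <> 0%N) ->
  slope (tensor_weight theta theta') (tensor_dim d d') =
  slope theta d + slope theta' d'.
Proof.
move=> /(sum_dim_gt0 (Q := Q))/lt0r_neq0 d0 /(sum_dim_gt0 (Q := Q'))/lt0r_neq0 d'0.
rewrite /slope /tensor_dim.
have -> : \sum_b (d (b.1 : vertex Q) * d' (b.2 : vertex Q'))%N%:R =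
    (\sum_a (d a)%:R) * (\sum_a' (d' a')%:R) :> rat.
  rewrite big_distrlr /= pair_bigA; apply: eq_bigr => b _.
  by rewrite natrM.
have -> : \sum_(b : vertex (tensor_quiver Q Q'))
    tensor_weight theta theta' b * (d b.1 * d' b.2)%N%:R =
    (\sum_a theta a * (d a)%:R) * (\sum_a' (d' a')%:R) +
    (\sum_a (d a)%:R) * (\sum_a' theta' a' * (d' a')%:R).
  rewrite !big_distrlr /= !pair_bigA -big_split /=; apply: eq_bigr => b _.
  by rewrite natrM /tensor_weight mulrDl mulrA; congr (_ + _); rewrite mulrCA.
by rewrite addf_div // [X in _ = (_ + X) / _]mulrC.
Qed.

Lemma tensor_rep_stable (rho : rep k d) (sigma : rep k d') :
  slope_coprime (tensor_weight theta theta') (tensor_dim d d') ->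
  stable theta rho -> stable theta' sigma ->
  stable (tensor_weight theta theta') (tensor_rep rho sigma).
Proof.
move=> cop st st'.
have d0 := st.1; have d'0 := st'.1.
have mu := slope_tensor_dim d0 d'0.
split.
  have [a da] := d0; have [a' da'] := d'0.
  exists (a, a') => /eqP; rewrite /tensor_dim muln_eq0 /=.
  by case/orP => /eqP.
move=> M MM M0 M1.
pose e b := \dim (M b).
have e0 : exists b, e b <> 0%N.
  by case: M0 => b Mb; exists b => /eqP; rewrite dimv_eq0 => /eqP.
have dimT b : \dim (fullv : {vspace 'cV[k]_(tensor_dim d d' b)}) =
    tensor_dim d d' b by rewrite dimvf /dim /= muln1.
rewrite lt_neqAle; apply/andP; split.
  apply/eqP; apply: (cop e) => // [b|].
    by rewrite -dimT dimvS ?subvf.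
  case: M1 => b Mb; exists b => eb; apply: Mb; apply/eqP.
  rewrite eqEdim subvf; apply: eq_leq; exact: etrans (dimT b) (esym eb).
rewrite mu (slope_le _ _ e0).
have -> : \sum_b (tensor_weight theta theta' b - (slope theta d + slope theta' d'))
      * (e b)%:R =
    (\sum_a' \sum_a (theta a - slope theta d) * (e (a, a'))%:R) +
    (\sum_a \sum_a' (theta' a' - slope theta' d') * (e (a, a'))%:R).
  rewrite exchange_big /= !pair_bigA -big_split /=.
  apply: eq_bigr => -[a a'] _ /=; rewrite -mulrDl /tensor_weight /=.
  by congr (_ * _); rewrite opprD addrACA.
pose slice1 a a' (l : 'I_(d' a')) : 'Hom('cV[k]_(d a * d' a'), 'cV[k]_(d a)) :=
  linfun (fun v : 'cV[k]_(d a * d' a') => \col_i v (mxtens_index (i, l)) 0).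
pose slice2 a a' (l : 'I_(d a)) : 'Hom('cV[k]_(d a * d' a'), 'cV[k]_(d' a')) :=
  linfun (fun v : 'cV[k]_(d a * d' a') => \col_i v (mxtens_index (l, i)) 0).
have slice1E a a' l v i : slice1 a a' l v i 0 = v (mxtens_index (i, l)) 0.
  have lT : linear (fun v : 'cV[k]_(d a * d' a') =>
      \col_i v (mxtens_index (i, l)) 0 : 'cV[k]_(d a)).
    by move=> c u w; apply/colP => j; rewrite !mxE.
  pose h := GRing.isLinear.Build _ _ _ _ _ lT.
  pose F : {linear _ -> _} := HB.pack (fun v : 'cV[k]_(d a * d' a') =>
      \col_i v (mxtens_index (i, l)) 0 : 'cV[k]_(d a)) h.
  by rewrite (lfunE F) mxE.
have slice2E a a' l v i : slice2 a a' l v i 0 = v (mxtens_index (l, i)) 0.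
  have lT : linear (fun v : 'cV[k]_(d a * d' a') =>
      \col_i v (mxtens_index (l, i)) 0 : 'cV[k]_(d' a')).
    by move=> c u w; apply/colP => j; rewrite !mxE.
  pose h := GRing.isLinear.Build _ _ _ _ _ lT.
  pose F : {linear _ -> _} := HB.pack (fun v : 'cV[k]_(d a * d' a') =>
      \col_i v (mxtens_index (l, i)) 0 : 'cV[k]_(d' a')) h.
  by rewrite (lfunE F) mxE.
have mulE m n p q (A : 'M[k]_(m, p)) (B : 'M[k]_(n, q)) (v : 'cV[k]_(p * q)) i j :
    (tensmx A B *m v) (mxtens_index (i, j)) 0 =
    \sum_i' \sum_j' A i i' * B j j' * v (mxtens_index (i', j')) 0.
  rewrite mxE (reindex (fun ij : 'I_p * 'I_q => mxtens_index ij)) /=; last first.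
    exists (@mxtens_unindex p q) => ij _;
    by rewrite ?mxtens_indexK ?mxtens_unindexK.
  by rewrite pair_bigA; apply: eq_bigr => -[i' j'] _; rewrite tensmxE.
have lmulE m n (A : 'M[k]_(m, n)) (v : 'cV[k]_n) : linfun (mulmx A) v = A *m v.
  by rewrite lfunE.
rewrite -[leRHS]addr0; apply: lerD; apply: sumr_le0.
- move=> a' _; apply: (@copies_semistable k Q theta d rho st (d' a')
    (fun a => 'cV[k]_(d a * d' a') : vectType k)
    (fun alpha => linfun (mulmx
            (tensmx (rho alpha) (1%:M : 'M[k]_(d' a')))))
    (fun l a => slice1 a a' l) (fun a => M (a, a'))).
  + move=> a v v0; apply/colP => l; case: (mxtens_indexP l) => i j.
    by rewrite -slice1E v0 !mxE.
  + move=> l alpha v; apply/colP => i; rewrite slice1E lmulE mulE mxE.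
    apply: eq_bigr => i' _; rewrite (bigD1 l) //= big1 => [|j' jl]; last first.
      by rewrite mxE eq_sym (negbTE jl) mulr0 mul0r.
    by rewrite mxE eqxx mulr1 addr0 slice1E.
  + by move=> alpha v vM; rewrite lmulE; exact: (MM (inr (alpha, a'))).
- move=> a _; apply: (@copies_semistable k Q' theta' d' sigma st' (d a)
    (fun a' => 'cV[k]_(d a * d' a') : vectType k)
    (fun alpha => linfun (mulmx
            (tensmx (1%:M : 'M[k]_(d a)) (sigma alpha))))
    (fun l a' => slice2 a a' l) (fun a' => M (a, a'))).
  + move=> a' v v0; apply/colP => l; case: (mxtens_indexP l) => i j.
    by rewrite -slice2E v0 !mxE.
  + move=> l alpha v; apply/colP => i; rewrite slice2E lmulE mulE mxE.
    rewrite exchange_big; apply: eq_bigr => i' _.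
    rewrite (bigD1 l) //= big1 => [|j' jl]; last first.
      by rewrite mxE eq_sym (negbTE jl) !mul0r.
    by rewrite mxE eqxx mul1r addr0 slice2E.
  + by move=> alpha v vM; rewrite lmulE; exact: (MM (inl (a, alpha))).
Qed.

End TensorStable.

Definition rep_space (k : fieldType) (Q : quiver) (d : vertex Q -> nat) :
    funSpace k :=
  @gen_space k (rep k d) (fun U f => U = setT /\
    exists alpha i j, f = fun rho : rep k d => rho alpha i j).

Definition stable_locus (k : fieldType) (Q : quiver) (theta : vertex Q -> rat)
    (d : vertex Q -> nat) : funSpace k :=
  subspace ([set rho | stable theta rho] : set (rep_space k d)).

Definition rep_of (k : fieldType) (Q : quiver) (theta : vertex Q -> rat)
    (d : vertex Q -> nat) (x : stable_locus k theta d) : rep k d := incl _ x.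

Lemma stable_rep_of (k : fieldType) (Q : quiver) (theta : vertex Q -> rat)
    (d : vertex Q -> nat) (x : stable_locus k theta d) : stable theta (rep_of x).
Proof. exact: (@set_valP _ [set rho : rep k d | stable theta rho] x). Qed.

(** [tensor_rep] as a map from the product of the stable loci to the stable locus. *)
Definition tensor_stable (k : fieldType) (Q Q' : quiver)
    (theta : vertex Q -> rat) (theta' : vertex Q' -> rat)
    (d : vertex Q -> nat) (d' : vertex Q' -> nat)
    (cop : slope_coprime (tensor_weight theta theta') (tensor_dim d d'))
    (x : stable_locus k theta d) (y : stable_locus k theta' d') :
    stable_locus k (tensor_weight theta theta') (tensor_dim d d') :=
  exist _ (tensor_rep (rep_of x) (rep_of y))
    (mem_set (tensor_rep_stable cop (stable_rep_of x) (stable_rep_of y))).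

Record gauge (k : fieldType) (Q : quiver) (d : vertex Q -> nat) := Gauge {
  gauge_mx :> forall a, 'M[k]_(d a);
  gauge_unit : forall a, gauge_mx a \in unitmx }.

Definition rep_act (k : fieldType) (Q : quiver) (d : vertex Q -> nat)
    (rho : rep k d) (g : gauge k d) : rep k d :=
  fun alpha => invmx (g (tgt alpha)) *m rho alpha *m g (src alpha).

(** The scalars act trivially, so the orbits of the gauge group are also those
  of its quotient by them. *)
Definition gauge_orbit (k : fieldType) (Q : quiver) (theta : vertex Q -> rat)
    (d : vertex Q -> nat) (x y : stable_locus k theta d) : Prop :=
  exists g : gauge k d, rep_of y = rep_act (rep_of x) g.

Definition moduli_space (k : fieldType) (Q : quiver) (theta : vertex Q -> rat)
    (d : vertex Q -> nat) (N : funSpace k)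
    (p : morphism (stable_locus k theta d) N) : Prop :=
  geometric_quotient (@gauge_orbit k Q theta d) p.

Definition gauge_char (k : fieldType) (Q : quiver) (d : vertex Q -> nat)
    (r : vertex Q -> int) (g : gauge k d) : k :=
  \prod_a \det (g a) ^ (- r a).

(** [descent] is the equivariant isomorphism of p^*U_a with the trivial bundle
  E_a, and [univ_map] descends the maps rho_alpha. On p^*U_a the group acts through
  the base only: (x, u) g = (xg, u), where u is a point of the total space
  of U_a over p(x) = p(xg). *)
Record universal_family (k : fieldType) (Q : quiver) (theta : vertex Q -> rat)
    (d : vertex Q -> nat) (r : vertex Q -> int) (N : funSpace k)
    (p : morphism (stable_locus k theta d) N) := UniversalFamily {
  univ_bundle : forall a, vbundle N (d a);
  univ_map : forall (alpha : arrow Q) (y : N),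
    'Hom(fiber (univ_bundle (src alpha)) y, fiber (univ_bundle (tgt alpha)) y);
  descent : forall a x, 'Hom(fiber (pullback p (univ_bundle a)) x,
    fiber (trivial_bundle (stable_locus k theta d) (d a)) x);
  univ_map_bundle_map : forall alpha, bundle_map (univ_map alpha);
  descent_iso : forall a, bundle_iso (descent a);
  descent_equivariant : forall a (x x' : stable_locus k theta d) (g : gauge k d),
    rep_of x' = rep_act (rep_of x) g ->
    forall (u : fiber (univ_bundle a) (p x)) (u' : fiber (univ_bundle a) (p x')),
      existT (fiber (univ_bundle a)) (p x) u =
        existT (fiber (univ_bundle a)) (p x') u' ->
      descent a x' u' =
        (gauge_char r g)^-1 *: (invmx (g a) *m descent a x u);
  descent_univ_map : forall alpha (x : stable_locus k theta d)
    (u : fiber (univ_bundle (src alpha)) (p x)),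
    descent (tgt alpha) x (univ_map alpha (p x) u) =
      rep_of x alpha *m descent (src alpha) x u }.

(* Main.v *)
Require Import Defs.
From HB Require Import structures.
From mathcomp Require Import all_boot all_order all_algebra perm ring.
From mathcomp Require Import all_classical topology.
From mathcomp.real_closed Require Import mxtens.

Set Implicit Arguments.
Unset Strict Implicit.
Unset Printing Implicit Defensive.
Import Order.TTheory GRing.Theory Num.Theory.

Local Open Scope classical_set_scope.
Local Open Scope ring_scope.

(** Let x and y be stable representations over the two coordinates of a point z of
  N_1 x N_2. The descent isomorphisms at x, y and their tensor product identify both
  fibres over z with V_a (x) W_a', hence with each other. Replacing x, y by xg, yh
  multiplies both identifications by the inverse of
  chi_3(g (x) h) (g_a (x) h_a'), because det(g (x) h) = det(g)^n det(h)^m and the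
  normalisations of r, r' give chi_3(g (x) h) = chi_1(g) chi_2(h); so the
  isomorphism of the fibres does not depend on the choices. It is regular since
  p_1 and p_2 have regular local sections: in local trivialisations of U_1, the
  maps psi_1 are matrices of regular functions on N_1, which form a representation
  in the orbit over the given point. *)

(** * Determinants and inverses of Kronecker products *)

(** Rows and columns undergo the same permutation, so the two signs cancel. The equation [m = n] is
    a hypothesis so that sizes such as [m * n] and [n * m] can be matched. *)
Lemma det_mxsub_inj (R : comNzRingType) m n (f : 'I_m -> 'I_n) (A : 'M[R]_n) :
  m = n -> injective f -> \det (mxsub f f A) = \det A.
Proof.
move=> mn; case: n / mn f A => f A f_inj.
have -> : mxsub f f A = row_perm (perm f_inj) (col_perm (perm f_inj) A).
  by apply/matrixP => i j; rewrite !mxE !permE.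
rewrite row_permE col_permE !det_mulmx !det_perm odd_permV mulrCA.
by rewrite mulrA -mulrA -expr2 sqrr_sign mulr1.
Qed.

(** The matrix is block diagonal with [m] copies of [B]; the induction splits off the first
    block. *)
Lemma det_tensmx1l (R : comNzRingType) m n (B : 'M[R]_n) :
  \det (tensmx (1%:M : 'M_m) B) = \det B ^+ m.
Proof.
elim: m => [|m IH]; first by rewrite det_mx00.
have -> : tensmx (1%:M : 'M_m.+1) B =
    block_mx B 0 0 (tensmx (1%:M : 'M_m) B) :> 'M_(n + m * n).
  have lE (i : 'I_n) : mxtens_unindex (lshift (m * n) i : 'I_(m.+1 * n)) = (ord0, i).
    by congr (_, _); apply: val_inj; rewrite /= ?divn_small ?modn_small.
  have rE (i : 'I_(m * n)) : mxtens_unindex (rshift n i : 'I_(m.+1 * n)) =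
      (lift ord0 (mxtens_unindex i).1, (mxtens_unindex i).2).
    (* An index in ['I_(m * n)] exists, which forces [n] to be positive, as the division by [n]
       below requires. *)
    have n0 : (0 < n)%N by case: n i {B IH lE} => // -[]; rewrite muln0.
    congr (_, _); apply: val_inj; rewrite /= ?modnDl //.
    by rewrite divnDl ?dvdnn // divnn n0.
  apply/matrixP => i j; rewrite [LHS]mxE.
  case: (split_ordP i) => i' ->; case: (split_ordP j) => j' ->;
    rewrite ?lE ?rE ?block_mxEul ?block_mxEur ?block_mxEdl ?block_mxEdr !mxE.
  - by rewrite eqxx mul1r.
  - by rewrite mul0r.
  - by rewrite mul0r.
  - by rewrite (inj_eq lift_inj).
by rewrite det_ublock IH exprS.
Qed.

Lemma det_tensmx (R : comNzRingType) m n (A : 'M[R]_m) (B : 'M[R]_n) :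
  \det (tensmx A B) = \det A ^+ n * \det B ^+ m.
Proof.
rewrite -[A]mulmx1 -[B in LHS]mul1mx -tensmx_mul det_mulmx det_tensmx1l mulmx1.
congr (_ * _); rewrite -det_tensmx1l.
(* After factoring through [tensmx A 1%:M], swapping the two tensor indices turns this factor into
   [tensmx 1%:M A]. *)
pose f (l : 'I_(m * n)) := mxtens_index ((mxtens_unindex l).2, (mxtens_unindex l).1).
rewrite -(@det_mxsub_inj _ _ _ f); first last.
- move=> l l' /(can_inj (@mxtens_indexK _ _)) e.
  apply: (can_inj (@mxtens_unindexK _ _)).
  by case: (mxtens_unindex l) (mxtens_unindex l') e => i j [i' j'] [-> ->].
- exact: mulnC.
congr (\det _); apply/matrixP => i j.
by rewrite !mxE !mxtens_indexK /= mulrC.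
Qed.

Lemma tensmx11 (R : pzRingType) m n :
  tensmx (1%:M : 'M[R]_m) (1%:M : 'M_n) = 1%:M.
Proof.
apply/matrixP => i j; case: (mxtens_indexP i) => i1 i2.
case: (mxtens_indexP j) => j1 j2.
rewrite tensmxE !mxE (inj_eq (can_inj (@mxtens_indexK _ _))) xpair_eqE.
by rewrite -natrM mulnb.
Qed.

Lemma invmx_tensmx (R : comUnitRingType) m n (A : 'M[R]_m) (B : 'M[R]_n) :
  A \in unitmx -> B \in unitmx -> tensmx A B \in unitmx /\
  invmx (tensmx A B) = tensmx (invmx A) (invmx B).
Proof.
move=> uA uB.
have AB1 : tensmx A B *m tensmx (invmx A) (invmx B) = 1%:M.
  by rewrite tensmx_mul !mulmxV // tensmx11.
have [uAB _] := mulmx1_unit AB1; split => //.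
by rewrite -[LHS]mulmx1 -AB1 mulKmx.
Qed.

Lemma exprz_sum (k : fieldType) (I : finType) (x : k) (n : I -> int) : x != 0 ->
  x ^ (\sum_i n i) = \prod_i x ^ n i.
Proof.
move=> x0; apply: (big_morph (fun m : int => x ^ m) (id1 := 1) (op1 := *%R)).
  by move=> m m'; rewrite expfzDr.
by rewrite expr0z.
Qed.

(** * Linear bijections and their matrices *)

Lemma bijective_lfunV (k : fieldType) (V W : vectType k) (f : 'Hom(V, W)) :
  bijective f -> exists g : 'Hom(W, V), cancel f g /\ cancel g f.
Proof.
move=> [f' fK f'K].
have f0 : lker f == 0%VS by apply/lker0P; exact: can_inj fK.
by exists f^-1%VF; split=> [|w]; [exact: lker0_lfunK|rewrite -(f'K w) lker0_lfunK].
Qed.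

(** Used to produce the gauge element that compares a frame with local trivialisations. *)
Lemma lfun_bij_mx (k : fieldType) (V : vectType k) n (f f' : 'Hom(V, 'cV[k]_n)) :
  bijective f -> bijective f' ->
  exists2 g : 'M[k]_n, g \in unitmx & forall v, f v = g *m f' v.
Proof.
(* Applying [H] in both directions gives two matrices whose product is the identity, hence
   invertibility. *)
suff H (h h' : 'Hom(V, 'cV[k]_n)) : bijective h' ->
    exists g : 'M[k]_n, forall v, h v = g *m h' v.
  move=> bf bf'; have [g gE] := H f f' bf'; have [g' g'E] := H f' f bf.
  exists g => //; case: bf bf' => [i _ iK] [i' _ i'K].
  have gg' : g *m g' = 1%:M.
    apply/trmx_inj/row_matrixP => j; apply/trmx_inj; rewrite !tr_row !trmxK.
    by rewrite colE -mulmxA -(iK (delta_mx j 0)) -g'E -gE colE mul1mx.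
  by have [] := mulmx1_unit gg'.
case=> i iK i'K.
have li : linear i.
  by move=> c u w; apply: (can_inj iK); rewrite linearP /= !i'K.
pose hi := GRing.isLinear.Build _ _ _ _ _ li.
pose I : {linear 'cV[k]_n -> V} := HB.pack i hi.
(* The columns are the [h]-images of the basis of [V] that [h'] sends to the standard basis. *)
exists (\matrix_(r, s) h (i (delta_mx s 0)) r 0) => v.
apply/colP => r; rewrite mxE -{1}(iK v).
rewrite [h' v in LHS](matrix_sum_delta) (_ : i = I) // !linear_sum summxE.
apply: eq_bigr => s _; rewrite big_ord1 !linearZ !mxE.
by rewrite mulrC.
Qed.

(** * Matrices and maps regular at a point *)

Lemma mx_regular_at_mul (k : fieldType) (X : funSpace k) m n l
    (A : X -> 'M[k]_(m, n)) (B : X -> 'M[k]_(n, l)) x :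
  mx_regular_at A x -> mx_regular_at B x ->
  mx_regular_at (fun y => A y *m B y) x.
Proof.
move=> rA rB i j; suff: regular_at (fun y => \sum_s A y i s * B y s j) x.
  by apply: regular_at_eq; apply: nearW => y; rewrite mxE.
elim: (index_enum _) => [|s e IH].
  apply: regular_at_eq (regular_at_cst 0 x).
  by apply: nearW => y; rewrite big_nil.
apply: regular_at_eq (regular_atD (regular_atM (rA i s) (rB s j)) IH).
by apply: nearW => y; rewrite big_cons.
Qed.

Lemma mx_regular_at_tens (k : fieldType) (X : funSpace k) m n m' n'
    (A : X -> 'M[k]_(m, n)) (B : X -> 'M[k]_(m', n')) x :
  mx_regular_at A x -> mx_regular_at B x ->
  mx_regular_at (fun y => tensmx (A y) (B y)) x.
Proof.
move=> rA rB i j; apply: regular_at_eq (regular_atM (rA (mxtens_unindex i).1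
  (mxtens_unindex j).1) (rB (mxtens_unindex i).2 (mxtens_unindex j).2)).
by apply: nearW => y; rewrite mxE.
Qed.

(** A pointwise form of [morphism], suited to local sections: these are total functions that are
    controlled only near a base point. *)
Definition regular_map_at (k : fieldType) (X Y : funSpace k) (s : X -> Y)
    (x : X) : Prop :=
  {for x, continuous s} /\
  forall g : Y -> k, regular_at g (s x) -> regular_at (g \o s) x.

Lemma morphism_regular_map_at (k : fieldType) (X Y : funSpace k)
  (f : morphism X Y) x : regular_map_at f x.
Proof. by split; [exact: mor_continuous|move=> g; exact: mor_regular]. Qed.

Lemma regular_map_at_comp (k : fieldType) (X Y Z : funSpace k) (s : X -> Y)
    (t : Y -> Z) x :
  regular_map_at s x -> regular_map_at t (s x) -> regular_map_at (t \o s) x.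
Proof.
move=> [cs rs] [ct rt]; split; first exact: continuous_comp.
by move=> g /rt /rs.
Qed.

(** By induction on [generated], both conditions pass from [B] to sums, products and inverses. *)
Lemma gen_space_regular_map_at (k : fieldType) (T : Type)
    (B : set T -> (T -> k) -> Prop) (X : funSpace k) (s : X -> gen_space B) x :
  (forall U f, B U f -> U (s x) ->
     (\forall y \near x, U (s y)) /\ regular_at (f \o s) x) ->
  regular_map_at s x.
Proof.
move=> sB.
have sgen U f : generated B U f -> U (s x) ->
    (\forall y \near x, U (s y)) /\ regular_at (f \o s) x.
  elim=> {U f} [U f /sB//|c _|U V f g _ IU _ IV|U V f g _ IU _ IV|U f _ IU].
  - by split; [exact: nearW|exact: regular_at_cst].
  - case=> /IU[? ?] /IV[? ?].
    by split; [exact: filterI|exact: regular_atD].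
  - case=> /IU[? ?] /IV[? ?].
    by split; [exact: filterI|exact: regular_atM].
  - case=> /IU[nU rf] /= fx; have [nf ?] := regular_atV rf fx.
    by split => //; exact: filterI.
split=> [A /gen_nearE[U [f [gU Ux UA]]]|g [U [f [gU Ux gf]]]].
  rewrite /= nbhs_simpl /=.
  by have [nU _] := sgen _ _ gU Ux; apply: filterS nU => y /UA.
have [nU rf] := sgen _ _ gU Ux.
by apply: regular_at_eq rf; apply: filterS nU => y /gf.
Qed.

Lemma subspace_regular_map_at (k : fieldType) (X Y : funSpace k) (A : set Y)
    (s : X -> Defs.subspace A) x :
  regular_map_at (Defs.incl A \o s) x -> regular_map_at s x.
Proof.
move=> [cs rs]; apply: gen_space_regular_map_at => _ _ [U [g [[oU rg] -> ->]]] Ux.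
split; last exact: (rs g (rg _ Ux)).
by apply: (cs U); exact: open_nbhs_nbhs.
Qed.

(** * Regularity and the gauge action on the stable locus *)

Section Loci.
Variables (k : fieldType) (Q : quiver) (theta : vertex Q -> rat).
Variable d : vertex Q -> nat.

Lemma stable_locus_regular_map_at (X : funSpace k)
    (s : X -> stable_locus k theta d) x :
  (forall alpha, mx_regular_at (fun y => rep_of (s y) alpha) x) ->
  regular_map_at s x.
Proof.
move=> rs; apply: subspace_regular_map_at; apply: gen_space_regular_map_at.
by move=> _ _ [-> [alpha [i [j ->]]]] _; split; [exact: nearW|exact: rs].
Qed.

Lemma mx_regular_at_rep_of (x : stable_locus k theta d) alpha :
  mx_regular_at (fun y : stable_locus k theta d => rep_of y alpha) x.
Proof.
move=> i j.
apply: (@mor_regular _ _ _ (Defs.incl [set rho : rep_space k d | stable theta rho])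
  (fun rho : rep_space k d => rho alpha i j)).
by apply: gen_base_regular (I : setT _); split => //; exists alpha, i, j.
Qed.

(** Multiplication by [g] carries subrepresentations of [rep_act rho g] to subrepresentations of
    [rho] of the same dimensions. *)
Lemma rep_act_stable (rho : rep k d) (g : gauge k d) :
  stable theta rho -> stable theta (rep_act rho g).
Proof.
move=> [d0 st]; split=> // S SS [a0 S0] [a1 S1].
have mulE m n (A : 'M[k]_(m, n)) v : linfun (mulmx A) v = A *m v :> 'cV[k]_m.
  by rewrite lfunE.
pose S' a := (linfun (mulmx (g a)) @: S a)%VS.
have kerg a : lker (linfun (mulmx (g a)) : 'End('cV[k]_(d a))) = 0%VS.
  apply/eqP/lker0P => u v; rewrite !mulE.
  by move/(can_inj (mulKmx (gauge_unit g a))).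
have dimS a : \dim (S' a) = \dim (S a).
  by apply: limg_dim_eq; rewrite kerg capv0.
under eq_fun do rewrite -dimS.
apply: st.
- move=> alpha _ /memv_imgP[u uS ->].
  have /(memv_img (linfun (mulmx (g (tgt alpha))))) := SS alpha u uS.
  by rewrite !mulE /rep_act !mulmxA mulmxV ?gauge_unit // mul1mx -mulmxA.
- exists a0 => S'0; apply: S0; apply/eqP.
  by rewrite -dimv_eq0 -dimS S'0 dimv0.
- exists a1 => S'1; apply: S1; apply/eqP.
  by rewrite eqEdim subvf -dimS S'1 /=.
Qed.

End Loci.

(** * Frames of the universal bundles and local sections of the quotient map *)

Section Frames.
Variables (k : fieldType) (Q : quiver) (theta : vertex Q -> rat).
Variables (d : vertex Q -> nat) (r : vertex Q -> int) (N : funSpace k).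
Variable p : morphism (stable_locus k theta d) N.
Variable U : universal_family r p.

(* Stating the descent isomorphism on the fibre over any y with p x = y avoids
   transport along such equations later on. *)
Definition frame a (x : stable_locus k theta d) (y : N) (e : p x = y) :
    'Hom(fiber (univ_bundle U a) y, 'cV[k]_(d a)) :=
  match e in _ = y return 'Hom(fiber (univ_bundle U a) y, 'cV[k]_(d a)) with
  | erefl => descent U a x
  end.

Lemma frame_bij a x y (e : p x = y) : bijective (frame a e).
Proof.
case: y / e; have [_ [g [_ gK]]] := descent_iso U a.
by exists (g x); have [] := gK x.
Qed.

Lemma frame_univ_map alpha x y (e : p x = y) u :
  frame (tgt alpha) e (univ_map U alpha y u) = rep_of x alpha *m frame (src alpha) e u.
Proof. by case: y / e u => u; exact: descent_univ_map. Qed.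

Lemma frame_act a x x' y (e : p x = y) (e' : p x' = y) (g : gauge k d) u :
  rep_of x' = rep_act (rep_of x) g ->
  frame a e' u = (gauge_char r g)^-1 *: (invmx (g a) *m frame a e u).
Proof.
move=> xx'.
(* Since [e] and [e'] share the endpoint [y], only one can be eliminated by matching. The other
   becomes an equality in the total space, the form taken by [descent_equivariant]. *)
have H z (ez : p x' = z) (v : fiber (univ_bundle U a) z) : exists v',
    existT (fiber (univ_bundle U a)) z v = existT _ (p x') v' /\
    frame a ez v = descent U a x' v'.
  by case: z / ez v => v; exists v.
have [u' [uu' ->]] := H y e' u; case: y / e u uu' {e' H} => u uu'.
exact: descent_equivariant uu'.
Qed.

(** [P] and [P'] are the local matrices of the descent isomorphism and of its inverse, pulled back
    along the lift [s] of [h]. *)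
Lemma frame_regular (X : funSpace k) (h : X -> N)
    (s : X -> stable_locus k theta d) z a (i : atlas (univ_bundle U a)) :
  regular_map_at s z -> p (s z) = h z -> chart_dom i (h z) ->
  exists P P' : X -> 'M[k]_(d a),
    [/\ mx_regular_at P z, mx_regular_at P' z &
    \forall y \near z, forall (e : p (s y) = h y) u,
      frame a e u = P y *m chart i (h y) u /\
      chart i (h y) u = P' y *m frame a e u].
Proof.
move=> [cs rs] sz iz; have [mD [g [mg gK]]] := descent_iso U a.
rewrite -sz in iz.
have [P [rP nP]] := mD (s z) i tt iz I.
have [P' [rP' nP']] := mg (s z) tt i I iz.
exists (P \o s), (P' \o s); split.
- by move=> l l'; exact: (rs _ (rP l l')).
- by move=> l l'; exact: (rs _ (rP' l l')).
- move: (cs _ nP) (cs _ nP') => /=; rewrite !nbhs_simpl /=.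
  move=> {}nP {}nP'; apply: filterS2 nP nP' => y /= Py P'y e.
  case: _ / e => u; have [fK _] := gK (s y).
  have := P'y (descent U a (s y) u); have := Py u.
  by rewrite /= !id_lfunE fK.
Qed.

(* The matrices of the universal maps in local trivialisations of the U_a form a
   representation depending regularly on the point of N. *)
Lemma local_section (y0 : N) : moduli_space p ->
  exists s : N -> stable_locus k theta d,
    regular_map_at s y0 /\ \forall y \near y0, p (s y) = y.
Proof.
case=> _ p_surj p_orb _ _.
have [x0 px0] := p_surj y0.
pose i a := projT1 (cid (chart_dom_cover (univ_bundle U a) y0)).
have iy0 a : chart_dom (i a) y0.
  exact: projT2 (cid (chart_dom_cover (univ_bundle U a) y0)).
pose M alpha :=
  projT1 (cid (univ_map_bundle_map (iy0 (src alpha)) (iy0 (tgt alpha)))).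
have HM alpha :=
  projT2 (cid (univ_map_bundle_map (iy0 (src alpha)) (iy0 (tgt alpha)))).
pose rho y : rep k d := fun alpha => M alpha y.
(* The default [x0] makes [s] total; near [y0] the representation [rho y] is shown to be stable and
   the first branch applies. *)
pose s y : stable_locus k theta d := if pselect (stable theta (rho y)) is left st
  then exist _ (rho y : rep_space k d) (mem_set st) else x0.
(* There are finitely many vertices and arrows, so the neighbourhoods can be intersected. *)
have nc : \forall y \near y0, forall a, chart_dom (i a) y.
  apply: filter_forall => a.
  have oi : open_nbhs y0 (chart_dom (i a)) by split; [exact: chart_dom_open|].
  exact: open_nbhs_nbhs oi.
have nM : \forall y \near y0, forall alpha u,
    chart (i (tgt alpha)) y (univ_map U alpha y u) =
    M alpha y *m chart (i (src alpha)) y u.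
  by apply: filter_forall => alpha; have [] := HM alpha.
have ns : \forall y \near y0, rep_of (s y) = rho y /\ p (s y) = y.
  apply: filterS2 nc nM => y cy My.
  have [x e] := p_surj y.
  have ex_g a : exists g : 'M[k]_(d a), g \in unitmx /\
      forall u, frame a e u = g *m chart (i a) y u.
    by have [g gu gE] := lfun_bij_mx (frame_bij a e) (chart_bij (cy a)); exists g.
  pose g := Gauge (fun a => (projT2 (cid (ex_g a))).1).
  have gE a u : frame a e u = g a *m chart (i a) y u.
    exact: (projT2 (cid (ex_g a))).2.
  (* In the charts, [rho y] is the universal map; in the frames at [x] it is [rep_of x]. The change
     of coordinates [g] therefore conjugates one into the other, which puts [rho y] in the orbit of
     [x]. *)
  have rhoE : rho y = rep_act (rep_of x) g.
    apply: functional_extensionality_dep => alpha.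
    have [c cK c'K] := chart_bij (cy (src alpha)).
    apply/trmx_inj/row_matrixP => j; apply/trmx_inj; rewrite !tr_row !trmxK.
    rewrite !colE -(c'K (delta_mx j 0)) /rho -My.
    rewrite /rep_act -!mulmxA -gE -frame_univ_map gE mulKmx //.
    exact: gauge_unit.
  have st : stable theta (rho y) by rewrite rhoE; exact/rep_act_stable/stable_rep_of.
  have sE : rep_of (s y) = rho y by rewrite /s; case: pselect.
  by split => //; rewrite -[RHS]e; apply/esym/p_orb; exists g; rewrite sE.
exists s; split; last by apply: filterS ns => y [].
apply: stable_locus_regular_map_at => alpha l l'.
apply: regular_at_eq (_ : regular_at (fun y => M alpha y l l') y0).
  by apply: filterS ns => y [-> _].
by have [rM _] := HM alpha; exact: rM.
Qed.

End Frames.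

(** * Tensor products of gauge elements and their characters *)

Section TensorGauge.
Variables (k : fieldType) (Q Q' : quiver).
Variables (d : vertex Q -> nat) (d' : vertex Q' -> nat).

Lemma tensor_gauge_unit (g : gauge k d) (h : gauge k d')
  (b : vertex (tensor_quiver Q Q')) : tensmx (g b.1) (h b.2) \in unitmx.
Proof. by have [] := invmx_tensmx (gauge_unit g b.1) (gauge_unit h b.2). Qed.

Definition tensor_gauge (g : gauge k d) (h : gauge k d') :
    gauge k (tensor_dim d d') :=
  @Gauge k (tensor_quiver Q Q') (tensor_dim d d')
    (fun b => tensmx (g b.1) (h b.2)) (tensor_gauge_unit g h).

Lemma invmx_tensor_gauge g h b : invmx (tensor_gauge g h b) =
  tensmx (invmx (g b.1)) (invmx (h b.2)).
Proof. by have [] := invmx_tensmx (gauge_unit g b.1) (gauge_unit h b.2). Qed.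

Lemma tensor_rep_act (rho : rep k d) (sigma : rep k d') g h :
  tensor_rep (rep_act rho g) (rep_act sigma h) =
  rep_act (tensor_rep rho sigma) (tensor_gauge g h).
Proof.
apply: functional_extensionality_dep => -[[a beta]|[alpha a']];
  rewrite /rep_act invmx_tensor_gauge /= !tensmx_mul.
- by rewrite mulmx1 mulVmx ?gauge_unit.
- by rewrite mulmx1 mulVmx ?gauge_unit.
Qed.

Lemma tensor_gauge_char (r : vertex Q -> int) (r' : vertex Q' -> int) g h :
  \sum_a (d a)%:Z * r a = 1 -> \sum_a' (d' a')%:Z * r' a' = 1 ->
  gauge_char (tensor_int r r') (tensor_gauge g h) =
  gauge_char r g * gauge_char r' h.
Proof.
move=> r1 r'1.
have g0 a : \det (g a) != 0 by rewrite -unitfE -unitmxE gauge_unit.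
have h0 a' : \det (h a') != 0 by rewrite -unitfE -unitmxE gauge_unit.
(* The exponents are grouped so that the product over [a'] of the first factors, and over [a] of the
   second, has inner exponents summing to 1. *)
transitivity (\prod_a \prod_a' (
    (\det (g a) ^ (- r a)) ^ ((d' a')%:Z * r' a') *
    (\det (h a') ^ (- r' a')) ^ ((d a)%:Z * r a))).
  rewrite pair_bigA; apply: eq_bigr => -[a a'] _.
  rewrite /= det_tensmx /tensor_int /= !exprnP.
  rewrite exprzMl ?unitfE ?expfz_neq0 // !exprz_exp.
  by congr (_ ^ _ * _ ^ _); ring.
under eq_bigr do rewrite big_split /=.
rewrite big_split /= [X in _ * X]exchange_big /=.
by congr (_ * _); apply: eq_bigr => b _;
  rewrite -exprz_sum ?expfz_neq0 // ?r1 ?r'1 expr1z.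
Qed.

End TensorGauge.

(** * Comparison of the fibres through tensor products of frames *)

Section TensorFrames.
Variables (k : fieldType) (Q Q' : quiver).
Variables (theta : vertex Q -> rat) (theta' : vertex Q' -> rat).
Variables (d : vertex Q -> nat) (d' : vertex Q' -> nat).
Variable cop : slope_coprime (tensor_weight theta theta') (tensor_dim d d').
Variables (r : vertex Q -> int) (r' : vertex Q' -> int).
Hypotheses (r_sum : \sum_a (d a)%:Z * r a = 1).
Hypotheses (r'_sum : \sum_a' (d' a')%:Z * r' a' = 1).
Variables (N1 N2 N3 : funSpace k).
Variables (p1 : morphism (stable_locus k theta d) N1).
Variables (p2 : morphism (stable_locus k theta' d') N2).
Variable p3 : morphism
  (stable_locus k (tensor_weight theta theta') (tensor_dim d d')) N3.
Hypotheses (N1_moduli : moduli_space p1) (N2_moduli : moduli_space p2).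
Variables (U1 : universal_family r p1) (U2 : universal_family r' p2).
Variable U3 : universal_family (tensor_int r r') p3.
Variable phibar : morphism (prod_space N1 N2) N3.
Hypothesis phibarE : forall x y, phibar (p1 x, p2 y) = p3 (tensor_stable cop x y).
Variables (a : vertex Q) (a' : vertex Q').

Local Notation b := ((a, a') : vertex (tensor_quiver Q Q')).

(** By [tensor_gauge_char] the two scalar factors combine into the one of [frame_act] for [U3], so
    tensor products of frames transform exactly like frames of [U3]. *)
Lemma tensor_frame_act x x' z1 (e1 : p1 x = z1) (e1' : p1 x' = z1)
    y y' z2 (e2 : p2 y = z2) (e2' : p2 y' = z2) (g : gauge k d) (h : gauge k d') t :
  rep_of x' = rep_act (rep_of x) g -> rep_of y' = rep_act (rep_of y) h ->
  tensor_coord (frame U1 a e1') (frame U2 a' e2') t =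
  (gauge_char (tensor_int r r') (tensor_gauge g h))^-1 *:
  (invmx (tensor_gauge g h b) *m tensor_coord (frame U1 a e1) (frame U2 a' e2) t).
Proof.
move=> xx' yy'; rewrite invmx_tensor_gauge tensor_gauge_char // invfM.
have c1 v : frame U1 a e1' v =
    ((gauge_char r g)^-1 *: invmx (g a)) *m frame U1 a e1 v.
  by rewrite -scalemxAl; exact: frame_act.
have c2 w : frame U2 a' e2' w =
    ((gauge_char r' h)^-1 *: invmx (h a')) *m frame U2 a' e2 w.
  by rewrite -scalemxAl; exact: frame_act.
rewrite (tensor_coord_mul c1 c2).
rewrite (_ : tensmx _ _ = ((gauge_char r g)^-1 / gauge_char r' h) *:
    tensmx (invmx (g a)) (invmx (h a'))); first by rewrite -scalemxAl.
by apply/matrixP => i j; rewrite !mxE mulrACA.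
Qed.

(** The maps are built from one choice of representatives, but the last clause holds for all of
    them; this allows regular sections to be substituted later. *)
Lemma fiber_tensor_iso (z : prod_space N1 N2) :
  exists (f : 'Hom(fiber (univ_bundle U3 b) (phibar z),
      tensor_space (fiber (univ_bundle U1 a) (pr1 N1 N2 z))
                   (fiber (univ_bundle U2 a') (pr2 N1 N2 z))))
    (g : 'Hom(tensor_space (fiber (univ_bundle U1 a) (pr1 N1 N2 z))
                   (fiber (univ_bundle U2 a') (pr2 N1 N2 z)),
      fiber (univ_bundle U3 b) (phibar z))),
    [/\ cancel f g, cancel g f & forall x y (e1 : p1 x = pr1 N1 N2 z)
      (e2 : p2 y = pr2 N1 N2 z) (e3 : p3 (tensor_stable cop x y) = phibar z) v,
      tensor_coord (frame U1 a e1) (frame U2 a' e2) (f v) = frame U3 b e3 v].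
Proof.
case: N1_moduli N2_moduli => _ surj1 orb1 _ _ [_ surj2 orb2 _ _].
have [x e1] := surj1 (pr1 N1 N2 z); have [y e2] := surj2 (pr2 N1 N2 z).
have e3 : p3 (tensor_stable cop x y) = phibar z.
  by rewrite -phibarE e1 e2; congr (phibar _); case: z {e1 e2}.
have [T [TK KT]] := bijective_lfunV
  (tensor_coord_bij (frame_bij U1 a e1) (frame_bij U2 a' e2)).
have [D [DK KD]] := bijective_lfunV (frame_bij U3 b e3).
exists (T \o frame U3 b e3)%VF.
exists (D \o tensor_coord (frame U1 a e1) (frame U2 a' e2))%VF.
split=> [v|t|x' y' e1' e2' e3' v].
- by rewrite !comp_lfunE KT DK.
- by rewrite !comp_lfunE KD TK.
(* Other representatives differ by gauge elements [g] and [h], and both sides acquire the same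
   factor. *)
have /orb1[g xx'] := etrans e1 (esym e1').
have /orb2[h yy'] := etrans e2 (esym e2').
rewrite (tensor_frame_act e1 e1' e2 e2' _ xx' yy') comp_lfunE KT.
rewrite (frame_act e3 e3' (g := tensor_gauge g h)) //.
by rewrite -tensor_rep_act -xx' -yy'.
Qed.

Lemma tensor_section_regular (X : funSpace k) (s : X -> stable_locus k theta d)
    (t : X -> stable_locus k theta' d') z :
  regular_map_at s z -> regular_map_at t z ->
  regular_map_at (fun y => tensor_stable cop (s y) (t y)) z.
Proof.
move=> [_ rs] [_ rt]; apply: stable_locus_regular_map_at.
case=> [[c beta]|[alpha c]]; apply: mx_regular_at_tens => i j;
  try exact: regular_at_cst.
- exact: (rt _ (mx_regular_at_rep_of (t z) (alpha := beta) i j)).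
- exact: (rs _ (mx_regular_at_rep_of (s z) (alpha := alpha) i j)).
Qed.

End TensorFrames.

(** * Regularity of the fibrewise isomorphisms *)

Theorem proposition3p4 (k : closedFieldType) (Q Q' : quiver)
  (theta : vertex Q -> rat) (theta' : vertex Q' -> rat)
  (d : vertex Q -> nat) (d' : vertex Q' -> nat)
  (d_gt0 : forall a, (0 < d a)%N) (d'_gt0 : forall a', (0 < d' a')%N)
  (d_coprime : coprime_dim d) (d_theta_coprime : slope_coprime theta d)
  (d'_coprime : coprime_dim d') (d'_theta_coprime : slope_coprime theta' d')
  (dbar_theta_coprime :
     slope_coprime (tensor_weight theta theta') (tensor_dim d d'))
  (r : vertex Q -> int) (r' : vertex Q' -> int)
  (r_sum : \sum_a (d a)%:Z * r a = 1)
  (r'_sum : \sum_a' (d' a')%:Z * r' a' = 1)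
  (N1 N2 N3 : funSpace k)
  (p1 : morphism (stable_locus k theta d) N1)
  (p2 : morphism (stable_locus k theta' d') N2)
  (p3 : morphism (stable_locus k (tensor_weight theta theta') (tensor_dim d d'))
          N3)
  (N1_moduli : moduli_space p1) (N2_moduli : moduli_space p2)
  (N3_moduli : moduli_space p3)
  (U1 : universal_family r p1) (U2 : universal_family r' p2)
  (U3 : universal_family (tensor_int r r') p3)
  (phibar : morphism (prod_space N1 N2) N3)
  (phibarE : forall (x : stable_locus k theta d) (y : stable_locus k theta' d'),
     phibar (p1 x, p2 y) = p3 (tensor_stable dbar_theta_coprime x y))
  (a : vertex Q) (a' : vertex Q') :
  bundle_isomorphic
    (pullback phibar (univ_bundle U3 ((a, a') : vertex (tensor_quiver Q Q'))))
    (tensor_bundle (pullback (pr1 N1 N2) (univ_bundle U1 a))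
                   (pullback (pr2 N1 N2) (univ_bundle U2 a'))).
Proof.
pose X := prod_space N1 N2; pose ab : vertex (tensor_quiver Q Q') := (a, a').
have iso := fiber_tensor_iso r_sum r'_sum N1_moduli N2_moduli U1 U2 U3 phibarE a a'.
pose f z := projT1 (cid (iso z)).
pose g z := projT1 (cid (projT2 (cid (iso z)))).
have fgP z := projT2 (cid (projT2 (cid (iso z)))).
(* The maps [f] and [g] are chosen point by point; their regularity is checked in charts around each
   [z]. *)
have local_matrices (z : X) (i : atlas (univ_bundle U3 ab))
    (j : atlas (univ_bundle U1 a)) (j' : atlas (univ_bundle U2 a')) :
    chart_dom i (phibar z) -> chart_dom j (pr1 N1 N2 z) ->
    chart_dom j' (pr2 N1 N2 z) ->
  exists M M' : X -> 'M[k]_(d a * d' a'),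
    [/\ mx_regular_at M z, mx_regular_at M' z & \forall y \near z,
      (forall v, tensor_coord (chart j (pr1 N1 N2 y)) (chart j' (pr2 N1 N2 y)) (f y v)
         = M y *m chart i (phibar y) v) /\
      (forall t, chart i (phibar y) (g y t) = M' y *m
         tensor_coord (chart j (pr1 N1 N2 y)) (chart j' (pr2 N1 N2 y)) t)].
  move=> iz jz jz'.
  have [s1 [rs1 ps1]] := local_section U1 (pr1 N1 N2 z) N1_moduli.
  have [s2 [rs2 ps2]] := local_section U2 (pr2 N1 N2 z) N2_moduli.
  (* Near [z], these and [t3] lift [pr1], [pr2] and [phibar] to the stable loci. *)
  pose t1 := s1 \o pr1 N1 N2; pose t2 := s2 \o pr2 N1 N2.
  pose t3 y := tensor_stable dbar_theta_coprime (t1 y) (t2 y).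
  have rt1 : regular_map_at t1 z.
    exact: regular_map_at_comp (morphism_regular_map_at _ _) rs1.
  have rt2 : regular_map_at t2 z.
    exact: regular_map_at_comp (morphism_regular_map_at _ _) rs2.
  have rt3 : regular_map_at t3 z by exact: tensor_section_regular.
  have pt1 : \forall y \near z, p1 (t1 y) = pr1 N1 N2 y.
    exact: (@mor_continuous _ _ _ (pr1 N1 N2) z _ ps1).
  have pt2 : \forall y \near z, p2 (t2 y) = pr2 N1 N2 y.
    exact: (@mor_continuous _ _ _ (pr2 N1 N2) z _ ps2).
  have pt3 y : p1 (t1 y) = pr1 N1 N2 y -> p2 (t2 y) = pr2 N1 N2 y ->
      p3 (t3 y) = phibar y.
    by move=> e1 e2; rewrite -phibarE e1 e2; congr (phibar _); case: (y).
  have e1z := nbhs_singleton pt1; have e2z := nbhs_singleton pt2.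
  have [P1 [Q1 [rP1 rQ1 n1]]] := frame_regular rt1 e1z jz.
  have [P2 [Q2 [rP2 rQ2 n2]]] := frame_regular rt2 e2z jz'.
  have [P3 [Q3 [rP3 rQ3 n3]]] := frame_regular rt3 (pt3 z e1z e2z) iz.
  (* [P3] passes from the chart of [U3] to its frame, where [f] becomes the identity on coordinates;
     [Q1] and [Q2] return to the charts of [U1] and [U2]. The second witness runs the other way. *)
  exists (fun y => tensmx (Q1 y) (Q2 y) *m P3 y).
  exists (fun y => Q3 y *m tensmx (P1 y) (P2 y)); split.
  - by apply: mx_regular_at_mul => //; exact: mx_regular_at_tens.
  - by apply: mx_regular_at_mul => //; exact: mx_regular_at_tens.
  - apply: filterS3 n1 n2 (filterI n3 (filterI pt1 pt2)) => y {}n1 {}n2 [{}n3 [e1 e2]].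
    have e3 := pt3 y e1 e2; have [_ gK fE] := fgP y; split=> [v|t].
    + rewrite (tensor_coord_mul (fun v => (n1 e1 v).2) (fun v => (n2 e2 v).2)).
      by rewrite -mulmxA -(n3 e3 v).1 -fE.
    + rewrite (n3 e3 _).2 -fE gK -mulmxA.
      by rewrite (tensor_coord_mul (fun v => (n1 e1 v).1) (fun v => (n2 e2 v).1)).
exists f; split; last (exists g; split).
- move=> z i [j j'] iz [jz jz'].
  have [M [M' [rM _ nM]]] := local_matrices z i j j' iz jz jz'.
  by exists M; split => //; apply: filterS nM => y [].
- move=> z [j j'] i [jz jz'] iz.
  have [M' [M [_ rM nM]]] := local_matrices z i j j' iz jz jz'.
  by exists M; split => //; apply: filterS nM => y [].
- by move=> z; have [] := fgP z.
Qed.
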